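(* Let $t\neq 0$, let $\lambda_0^t:\Omega\to\mathbb{R}$ be the largest eigenvalue of the Cauchy-Green deformation tensor of the flow from time $0$ to time $t$, and let $\sigma_0^t:\Omega\to\mathbb{R}$ be the corresponding finite time Lyapunov exponent (FTLE) function, $\sigma_0^t(\mathbf{x})=\frac{1}{|t|}\ln\sqrt{\lambda_0^t(\mathbf{x})}$. Then every $\sigma_0^t$-ridge is also a $\lambda_0^t$-ridge.
   Context: Flow. Let $\Omega\subset\mathbb{R}^d$ be a bounded domain and $\mathbf{u}:\Omega\times\mathbb{R}\to\mathbb{R}^d$ a (time dependent) Lipschitz velocity field. Consider the ODE $\mathbf{x}'(t)=\mathbf{u}(\mathbf{x}(t),t)$. The flow map $\Phi_a^b$ sends $\mathbf{x}_0\in\Omega$ to $\Phi_a^b(\mathbf{x}_0)=\mathbf{x}(b)$, where $\mathbf{x}$ is the solution with $\mathbf{x}(a)=\mathbf{x}_0$. Solutions are taken to exist for all initial points in $\Omega$ and all times considered, and $\Phi_0^t$ is taken to be differentiable in the spatial variable, so that its Jacobian $\nabla\Phi_0^t(\mathbf{x})$ is defined. Cauchy-Green tensor. $C_0^t(\mathbf{x})=[\nabla\Phi_0^t(\mathbf{x})]^*\,\nabla\Phi_0^t(\mathbf{x})$ (where $^*$ is the transpose), and $\lambda_0^t(\mathbf{x})=\lambda_{\max}(C_0^t(\mathbf{x}))$ is its largest eigenvalue. Ridge. For a scalar function $f$ on $\Omega$, an $f$-ridge is a codimension-one, compact, $C^1$ surface $\mathcal{M}\subset\Omega$ such that for every $\mathbf{x}\in\mathcal{M}$,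 $f(\mathbf{x})$ is a local maximum of $f$ along the normal direction to $\mathcal{M}$ at $\mathbf{x}$; that is, with $\mathbf{n}_{\mathbf{x}}$ a unit normal to $\mathcal{M}$ at $\mathbf{x}$, there is $\delta>0$ such that $f(\mathbf{x}+s\,\mathbf{n}_{\mathbf{x}})\le f(\mathbf{x})$ for all $|s|<\delta$. *)

(* Defs.v *)
From HB Require Import structures.
From mathcomp Require Import all_boot all_order all_algebra.
From mathcomp Require Import all_classical all_reals all_analysis.

Set Implicit Arguments.
Unset Strict Implicit.
Unset Printing Implicit Defensive.

Import Order.TTheory GRing.Theory Num.Theory.
Import numFieldNormedType.Exports.

Local Open Scope classical_set_scope.
Local Open Scope ring_scope.

(* Points and vectors of R^d are row vectors 'rV[R]_d.  The library norm on
   'rV[R]_d is the sup norm; it is only used for topological notions and for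
   Lipschitz continuity, which do not depend on the choice of norm.  Euclidean
   geometry (unit length, orthogonality) is expressed with [dotv].

   Functions on Omega are represented by functions on all of 'rV[R]_d whose
   values outside Omega are never used. *)

Definition dotv (R : realType) (d : nat) (v w : 'rV[R]_d) : R :=
  (v *m w^T) 0 0.

Definition bounded_domain (R : realType) (d : nat) (Omega : set 'rV[R]_d) :=
  [/\ open Omega, connected Omega, Omega !=set0 & bounded_set Omega].

Definition is_solution (R : realType) (d : nat) (Omega : set 'rV[R]_d)
    (u : 'rV[R]_d * R -> 'rV[R]_d) (J : set R) (x : R -> 'rV[R]_d) :=
  forall s, J s -> Omega (x s) /\ is_derive s 1 x (u (x s, s)).

(* Through every point of Omega there is a solution, defined on an open time
   interval containing a and b, and Phi maps its position at time a to its
   position at time b.  For a Lipschitz field the solution is unique, so this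
   determines Phi on Omega. *)
Definition is_flow_map (R : realType) (d : nat) (Omega : set 'rV[R]_d)
    (u : 'rV[R]_d * R -> 'rV[R]_d) (a b : R) (Phi : 'rV[R]_d -> 'rV[R]_d) :=
  forall x0, Omega x0 -> exists (J : set R) (x : R -> 'rV[R]_d),
    [/\ [/\ open J, is_interval J, J a & J b],
        is_solution Omega u J x, x a = x0 & Phi x0 = x b].

(* The library's [jacobian] acts on row vectors, its (i, j) entry being the
   i-th partial derivative of the j-th component; hence the transpose. *)
Definition grad (R : realType) (d : nat) (Phi : 'rV[R]_d -> 'rV[R]_d)
    (x : 'rV[R]_d) : 'M[R]_d := (jacobian Phi x)^T.

Definition cauchy_green (R : realType) (d : nat) (Phi : 'rV[R]_d -> 'rV[R]_d)
    (x : 'rV[R]_d) : 'M[R]_d := (grad Phi x)^T *m grad Phi x.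

(* The spectrum of a real symmetric matrix of positive size is finite and
   nonempty, so for such a matrix this supremum is a maximum. *)
Definition lambda_max (R : realType) (d : nat) (A : 'M[R]_d) : R :=
  sup [set a | eigenvalue A a].

Definition cg_lambda (R : realType) (d : nat) (Phi : 'rV[R]_d -> 'rV[R]_d)
    (x : 'rV[R]_d) : R := lambda_max (cauchy_green Phi x).

Definition ftle (R : realType) (d : nat) (t : R)
    (Phi : 'rV[R]_d -> 'rV[R]_d) (x : 'rV[R]_d) : R :=
  `|t|^-1 * ln (Num.sqrt (cg_lambda Phi x)).

Definition C1_on (R : realType) (d : nat) (U : set 'rV[R]_d)
    (g : 'rV[R]_d -> R) :=
  forall y, U y ->
    differentiable g y /\ forall v, {for y, continuous (fun z => 'd g z v)}.

(* Embedded C^1 submanifold (without boundary) of codimension one: locally the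
   zero set of a C^1 function with nonvanishing differential. *)
Definition C1_hypersurface (R : realType) (d : nat) (M : set 'rV[R]_d) :=
  forall x, M x -> exists (U : set 'rV[R]_d) (g : 'rV[R]_d -> R),
    [/\ open U /\ U x, C1_on U g, (exists v, 'd g x v != 0) &
        M `&` U = [set y | U y /\ g y = 0]].

Definition tangent_vector (R : realType) (d : nat) (M : set 'rV[R]_d)
    (x v : 'rV[R]_d) :=
  exists c : R -> 'rV[R]_d,
    [/\ c 0 = x, \forall s \near (0 : R), M (c s) & is_derive (0 : R) 1 c v].

Definition unit_normal (R : realType) (d : nat) (M : set 'rV[R]_d)
    (x n : 'rV[R]_d) :=
  dotv n n = 1 /\ forall v, tangent_vector M x v -> dotv n v = 0.

Definition ridge (R : realType) (d : nat) (Omega : set 'rV[R]_d)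
    (f : 'rV[R]_d -> R) (M : set 'rV[R]_d) :=
  [/\ C1_hypersurface M, compact M, M `<=` Omega &
      forall x n, M x -> unit_normal M x n ->
        exists2 delta : R, 0 < delta &
          forall s : R, `|s| < delta ->
            Omega (x + s *: n) /\ f (x + s *: n) <= f x].

(* Main.v *)
Require Import Defs.
From HB Require Import structures.
From mathcomp Require Import all_boot all_order all_algebra.
From mathcomp Require Import all_classical all_reals all_analysis.
From mathcomp Require Import complex polyrcf ring lra.
Import Order.TTheory GRing.Theory Num.Theory.
Import numFieldNormedType.Exports.
Local Open Scope classical_set_scope.
Local Open Scope ring_scope.

(** Since [ln] and [Num.sqrt] increase on the positive reals, an inequality
    between FTLE values gives the same inequality between the largest
    eigenvalues, and the ridge condition transfers pointwise.  The one thing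
    that could break this is a degenerate point: where the largest eigenvalue
    is not positive, [ln (Num.sqrt _)] has the default value [0], and could
    then dominate the logarithm of a positive eigenvalue smaller than [1].
    The mathematical content is therefore [cg_lambda_gt0]: the Cauchy-Green
    tensor of a Lipschitz flow has positive largest eigenvalue at every point
    of the domain.

    That the gradient is nondegenerate comes from Gronwall's inequality.  Along
    two solutions the squared Euclidean distance [E] satisfies [|E'| <= K E],
    so distances at one time are bounded by a constant multiple of distances at
    any other time ([gronwall], [solution_separation]), and the flow map
    satisfies [|x - y| <= C |Phi x - Phi y|] ([flow_map_expansion]).  Applied
    to difference quotients, this bound forces the differential of [Phi] to be
    injective ([expansive_jacobian_inj]).

    On the algebraic side, the Cauchy-Green tensor is then symmetric positive
    definite.  A real symmetric matrix of positive size has a real eigenvalue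
    ([symmetric_eigenvalue]), positive definiteness makes it positive, and
    boundedness of the spectrum puts it below the supremum that defines
    [lambda_max] ([lambda_max_gram_gt0]). *)

(** * Euclidean product and sup norm *)

Section DotProduct.
Context {R : realType} {d : nat}.
Implicit Types v w : 'rV[R]_d.

Lemma dotvE v w : dotv v w = \sum_i v 0 i * w 0 i.
Proof. by rewrite /dotv mxE; apply: eq_bigr => i _; rewrite mxE. Qed.

Lemma dotvC v w : dotv v w = dotv w v.
Proof. by rewrite !dotvE; apply: eq_bigr => i _; rewrite mulrC. Qed.

Lemma dotvDZl (k l : R) v1 v2 w :
  dotv (k *: v1 + l *: v2) w = k * dotv v1 w + l * dotv v2 w.
Proof. by rewrite /dotv mulmxDl -!scalemxAl !mxE. Qed.

Lemma dotvv_ge0 v : 0 <= dotv v v.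
Proof. by rewrite dotvE sumr_ge0// => i _; rewrite -expr2 sqr_ge0. Qed.

Lemma dotvv_eq0 v : (dotv v v == 0) = (v == 0).
Proof.
apply/eqP/eqP => [|->]; last by rewrite /dotv mul0mx mxE.
rewrite dotvE => /eqP; rewrite psumr_eq0; last first.
  by move=> i _; rewrite -expr2 sqr_ge0.
move=> /allP v0; apply/rowP => i; rewrite mxE; apply/eqP.
by have := v0 i (mem_index_enum i); rewrite /= mulf_eq0 orbb.
Qed.

Lemma dotvv_gt0 v : v != 0 -> 0 < dotv v v.
Proof. by move=> v0; rewrite lt_def dotvv_eq0 v0 dotvv_ge0. Qed.

Lemma entry_le_norm v i : `|v 0 i| <= `|v|.
Proof. by rewrite [leRHS]/Num.Def.normr/= mx_normrE (le_bigmax _ _ (0, i)). Qed.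

Lemma norm_dotv_le v w : `|dotv v w| <= d%:R * (`|v| * `|w|).
Proof.
rewrite dotvE (le_trans (ler_norm_sum _ _ _))//.
have -> : d%:R * (`|v| * `|w|) = \sum_(i < d) (`|v| * `|w|).
  by rewrite big_const_ord iter_addr_0 mulr_natl.
by apply: ler_sum => i _; rewrite normrM ler_pM// entry_le_norm.
Qed.

Lemma sqr_norm_le_dotv v : `|v| ^+ 2 <= dotv v v.
Proof.
have [->|] := eqVneq (`|v|) 0; first by rewrite expr0n dotvv_ge0.
rewrite {1 2}/Num.Def.normr/= => /mx_norm_neq0[[i j] /= ->].
rewrite real_normK ?num_real// dotvE ord1 (bigD1 j)//= expr2 lerDl.
by rewrite sumr_ge0// => k _; rewrite -expr2 sqr_ge0.
Qed.

End DotProduct.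

(** * Gronwall's inequality *)

(** The hypotheses say that the derivative of [f s * expR (c * s)] is
    nonnegative on the segment. *)
Lemma mul_expR_le {R : realType} {f df : R -> R} {c a b : R} :
    a <= b ->
    (forall s, a <= s <= b -> is_derive s 1 f (df s)) ->
    (forall s, a <= s <= b -> 0 <= df s + c * f s) ->
  f a * expR (c * a) <= f b * expR (c * b).
Proof.
move=> ab fdf fge; rewrite -subr_ge0.
pose g s := f s * expR (c * s).
pose dg s := (df s + c * f s) * expR (c * s).
have gdg s : a <= s <= b -> is_derive s 1 g (dg s).
  move=> /fdf fs.
  have es : is_derive s 1 (fun s => expR (c * s)) (c * expR (c * s)).
    have cs : is_derive s 1 ( *%R c) c.
      by have := @is_deriveZ _ _ _ (@idfun R) c s 1 1 (is_derive_id s 1);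
        rewrite /GRing.scale/= mulr1.
    by rewrite mulrC; exact: (@is_derive1_comp _ expR ( *%R c)).
  apply: (is_derive_eq (is_deriveM fs es)).
  by rewrite /dg /GRing.scale/=; ring.
have [x||s + ->] := @MVT_segment R g dg a b ab.
- by rewrite in_itv/= => /andP[/ltW ax /ltW xb]; apply: gdg; rewrite ax.
- apply: derivable_within_continuous => s; rewrite in_itv/= => sab.
  by have [] := gdg _ sab.
- rewrite in_itv/= => sab; rewrite mulr_ge0 ?subr_ge0//.
  by rewrite mulr_ge0 ?expR_ge0// fge.
Qed.

(** Since the bound is on the absolute value of the derivative, it works in both
    directions of time; the two orders of [a] and [b] are needed because the
    time of a flow map may be negative.  For [a <= b] the weight [expR (K * s)]
    makes [f] nondecreasing, for [b <= a] the weight [expR (- K * s)] makes it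
    nonincreasing. *)
Lemma gronwall {R : realType} {f df : R -> R} {K a b : R} :
    (forall s, Num.min a b <= s <= Num.max a b ->
       is_derive s 1 f (df s) /\ `|df s| <= K * f s) ->
  f a <= expR (K * `|b - a|) * f b.
Proof.
have [ab|/ltW ba] := leP a b.
- move=> fdf.
  have := @mul_expR_le R f df K a b ab (fun s h => (fdf s h).1).
  have h s : a <= s <= b -> 0 <= df s + K * f s.
    by move=> /fdf[_]; rewrite ler_norml => /andP[]; lra.
  move=> /(_ h); rewrite ger0_norm ?subr_ge0// mulrBr expRD expRN.
  by rewrite -ler_pdivlMr ?expR_gt0//; move/le_trans; apply; lra.
- move=> fdf.
  have dN s : b <= s <= a -> is_derive s 1 (\- f) (- df s).
    by move=> /fdf[? _]; exact: is_deriveN.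
  have h s : b <= s <= a -> 0 <= - df s + (- K) * - f s.
    by move=> /fdf[_]; rewrite ler_norml => /andP[]; lra.
  have := @mul_expR_le R (\- f) (fun s => - df s) (- K) b a ba dN h.
  rewrite ler0_norm ?subr_le0// opprB mulrBr expRD expRN !mulNr lerN2 !expRN.
  by rewrite ler_pdivrMr ?expR_gt0//; move/le_trans; apply; lra.
Qed.
(** * Spectrum of symmetric matrices *)

(** Over [R[i]] there is an eigenvalue [p +i* q], with an eigenvector
    [a + i b].  Comparing real and imaginary parts gives [a A = p a - q b] and
    [b A = p b + q a]; as [A] is symmetric, [(a A) . b = (b A) . a], which reads
    [q (a . a + b . b) = 0].  Hence [q = 0]. *)
Lemma symmetric_eigenvalue {R : realType} {d : nat} (A : 'M[R]_d) :
  (0 < d)%N -> A^T = A -> exists a, eigenvalue A a.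
Proof.
move=> d0 As.
pose toC : {rmorphism R -> R[i]} := real_complex R.
have [z zA] := eigenvalue_closed (map_mx toC A) d0.
suff z0 : complex.Im z = 0.
  exists (complex.Re z); rewrite -(eigenvalue_map toC).
  by rewrite (_ : toC _ = z)//; case: z z0 {zA} => p q /= ->.
have /eigenvalueP[w wA w0] := zA.
pose a := map_mx (@complex.Re R) w; pose b := map_mx (@complex.Im R) w.
case: z zA wA => p q zA wA /=.
have aA : a *m A = p *: a - q *: b.
  apply/rowP => j; have := congr1 (fun u : 'rV_d => complex.Re (u 0 j)) wA.
  rewrite !mxE raddf_sum/= => h; transitivity (complex.Re ((p +i* q)%C * w 0 j)).
    rewrite -h; apply: eq_bigr => k _; rewrite !mxE.
    by case: (w 0 k) => ? ? /=; rewrite mulr0 subr0.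
  by case: (w 0 j) => ? ?.
have bA : b *m A = p *: b + q *: a.
  apply/rowP => j; have := congr1 (fun u : 'rV_d => complex.Im (u 0 j)) wA.
  rewrite !mxE raddf_sum/= => h; transitivity (complex.Im ((p +i* q)%C * w 0 j)).
    rewrite -h; apply: eq_bigr => k _; rewrite !mxE.
    by case: (w 0 k) => ? ? /=; rewrite mulr0 add0r.
  by case: (w 0 j) => ? ? /=.
have sym : dotv (a *m A) b = dotv (b *m A) a.
  by rewrite [RHS]dotvC /dotv trmx_mul As mulmxA.
have : q * (dotv a a + dotv b b) = 0.
  by move: sym; rewrite aA bA -scaleNr !dotvDZl (dotvC b a); lra.
move=> /eqP; rewrite mulf_eq0 => /orP[/eqP//|].
rewrite paddr_eq0 ?dotvv_ge0// !dotvv_eq0 => /andP[/eqP a0 /eqP b0].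
case/eqP: w0; apply/rowP => j.
have := congr1 (fun u : 'rV_d => u 0 j) a0.
have := congr1 (fun u : 'rV_d => u 0 j) b0.
by rewrite !mxE; case: (w 0 j) => ? ? /= -> ->.
Qed.

Lemma eigenvalue_has_ubound {R : realType} {d : nat} (A : 'M[R]_d) :
  has_ubound [set a | eigenvalue A a].
Proof.
exists (cauchy_bound (char_poly A)) => a /=.
rewrite eigenvalue_root_char => /rootP /cauchy_boundP -/(_ _)/ltW.
move=> /(_ (monic_neq0 (char_poly_monic A))); exact/le_trans/ler_norm.
Qed.

(** If [v J J^T = a v], then [a (v . v) = (v J) . (v J)], so every eigenvalue of
    the Gram matrix of an injective [J] is positive. *)
Lemma lambda_max_gram_gt0 {R : realType} {d : nat} (J : 'M[R]_d) :
    (0 < d)%N -> (forall v : 'rV_d, v *m J = 0 -> v = 0) ->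
  0 < lambda_max (J *m J^T).
Proof.
move=> d0 Jinj.
have [a aA] : exists a, eigenvalue (J *m J^T) a.
  by apply: symmetric_eigenvalue => //; rewrite trmx_mul trmxK.
apply: (@lt_le_trans _ _ a); last first.
  exact: (ub_le_sup (eigenvalue_has_ubound _)).
have /eigenvalueP[v vA v0] := aA.
have vJ : dotv (v *m J) (v *m J) = a * dotv v v.
  by rewrite {1}/dotv trmx_mul mulmxA -(mulmxA v) vA -scalemxAl mxE.
rewrite -(pmulr_lgt0 a (dotvv_gt0 _ v0)) -vJ dotvv_gt0//.
by apply: contra v0 => /eqP /Jinj ->.
Qed.
(** * Separation of trajectories *)

Lemma is_derive_dotvv {R : realType} {d : nat} (x : R -> 'rV[R]_d) (s : R) (dx : 'rV[R]_d) :
  is_derive s 1 x dx ->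
  is_derive s 1 (fun r => dotv (x r) (x r)) (2 * dotv (x s) dx).
Proof.
move=> [xs xdx]; have xi i : is_derive s 1 (fun r => x r 0 i) (dx 0 i).
  have /derivable_mxP/(_ 0 i) xis := xs.
  by split=> //; rewrite -xdx derive_mx// mxE.
have -> : (fun r => dotv (x r) (x r)) = \sum_(i < d) (fun r => x r 0 i * x r 0 i).
  by apply/funext => r; rewrite dotvE fct_sumE.
apply: is_derive_eq; rewrite dotvE mulr_sumr; apply: eq_bigr => i _.
by rewrite /GRing.scale/=; ring.
Qed.

(** Gronwall's inequality is applied to the squared Euclidean distance, which
    unlike the sup norm is differentiable; passing between the Euclidean product
    and the sup norm, in which [u] is Lipschitz, costs the factor [d]. *)
Lemma solution_separation {R : realType} {d : nat} (Omega : set 'rV[R]_d)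
    (u : 'rV[R]_d * R -> 'rV[R]_d) (L : R) (J1 J2 : set R) (x y : R -> 'rV[R]_d)
    (a b : R) :
    L.-lipschitz_(Omega `*` [set: R]) u ->
    is_interval J1 -> J1 a -> J1 b -> is_interval J2 -> J2 a -> J2 b ->
    is_solution Omega u J1 x -> is_solution Omega u J2 y ->
  dotv (x a - y a) (x a - y a) <=
    expR (2 * (d%:R * `|L|) * `|b - a|) * dotv (x b - y b) (x b - y b).
Proof.
move=> uL J1i J1a J1b J2i J2a J2b xJ yJ.
apply: (@gronwall _ (fun s => dotv (x s - y s) (x s - y s))
  (fun s => 2 * dotv (x s - y s) (u (x s, s) - u (y s, s)))) => s sab.
have Js (J : set R) : is_interval J -> J a -> J b -> J s.
  move=> Ji Ja Jb; apply: (Ji (Num.min a b) (Num.max a b)) => //.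
  - by case: (leP a b).
  - by case: (leP a b).
have [xs dx] := xJ s (Js _ J1i J1a J1b); have [ys dy] := yJ s (Js _ J2i J2a J2b).
split.
  by apply: (@is_derive_dotvv _ _ (fun s => x s - y s)); exact: is_deriveB.
rewrite normrM ger0_norm// -!mulrA ler_pM2l//.
apply: (le_trans (norm_dotv_le _ _)); rewrite ler_wpM2l//.
have /= us := uL ((x s, s), (y s, s)) (conj (conj xs I) (conj ys I)).
have {us} us : `|u (x s, s) - u (y s, s)| <= `|L| * `|x s - y s|.
  apply: (le_trans us); rewrite [X in _ * X](_ : _ = `|x s - y s|).
    by rewrite ler_wpM2r// ler_norm.
  by rewrite prod_normE/= subrr normr0 max_l.
apply: (@le_trans _ _ (`|L| * `|x s - y s| ^+ 2)); last first.
  by rewrite ler_wpM2l// sqr_norm_le_dotv.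
by rewrite expr2 mulrCA ler_wpM2l.
Qed.

Lemma flow_map_expansion {R : realType} {d : nat} (Omega : set 'rV[R]_d)
    (u : 'rV[R]_d * R -> 'rV[R]_d) (a b : R) (Phi : 'rV[R]_d -> 'rV[R]_d) :
    [lipschitz u z | z in Omega `*` [set: R]] -> is_flow_map Omega u a b Phi ->
  exists C : R, forall x y, Omega x -> Omega y ->
    `|x - y| <= C * `|Phi x - Phi y|.
Proof.
move=> [L0 [_ /(_ (L0 + 1))]]; rewrite ltrDl ltr01 => /(_ isT) uL flow.
pose K := expR (2 * (d%:R * `|L0 + 1|) * `|b - a|) * d%:R.
have K0 : 0 <= K by rewrite mulr_ge0// expR_ge0.
(* The estimate holds for squared norms with the constant K, and K + 1 bounds
   the square root of K. *)
exists (K + 1) => x0 y0 /flow[J1 [x [[_ J1i J1a J1b] xJ <- ->]]].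
move=> /flow[J2 [y [[_ J2i J2a J2b] yJ <- ->]]].
have sep := solution_separation _ _ _ _ _ _ _ _ _ uL J1i J1a J1b J2i J2a J2b xJ yJ.
have sq : `|x a - y a| ^+ 2 <= K * `|x b - y b| ^+ 2.
  apply: (le_trans (sqr_norm_le_dotv _)); apply: (le_trans sep).
  rewrite /K -[leRHS]mulrA ler_wpM2l ?expR_ge0//.
  by apply: (le_trans (ler_norm _)); rewrite expr2 norm_dotv_le.
rewrite -(@ler_pXn2r _ 2)// ?nnegrE ?mulr_ge0 ?addr_ge0//.
apply: (le_trans sq); rewrite exprMn ler_wpM2r ?sqr_ge0//.
by nra.
Qed.

(** If [v] is in the kernel, the difference quotients of [Phi] along [v] tend to
    [0], while the expansion bound keeps [C] times their norm above the norm of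
    [v]. *)
Lemma expansive_jacobian_inj {R : realType} {d : nat} (Omega : set 'rV[R]_d)
    (Phi : 'rV[R]_d -> 'rV[R]_d) (C : R) (x v : 'rV[R]_d) :
    open Omega -> Omega x -> differentiable Phi x ->
    (forall y z, Omega y -> Omega z -> `|y - z| <= C * `|Phi y - Phi z|) ->
  v *m jacobian Phi x = 0 -> v = 0.
Proof.
move=> oO Ox dPhi exp; rewrite -deriveEjacobian// => D0.
have Dv : derivable Phi x v by exact: diff_derivable.
have qv : `|h^-1 *: (Phi (h *: v + x) - Phi x)| @[h --> 0^'] --> (0 : R).
  rewrite [X in _ --> X](_ : 0 = `|'D_v Phi x|); last by rewrite D0 normr0.
  by apply: cvg_norm; exact: Dv.
apply/eqP; rewrite -normr_eq0 eq_le normr_ge0 andbT -[leRHS](mulr0 C).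
apply: (cvgr_to_ge (cvgMl_tmp qv)).
have xhv : h *: v + x @[h --> 0^'] --> x.
  rewrite [X in _ --> X](_ : x = 0 *: v + x); last by rewrite scale0r add0r.
  by apply: cvgD; [apply: cvgZr_tmp; exact: cvg_within|exact: cvg_cst].
near=> h.
have h0 : h != 0 by near: h; exact: nbhs_dnbhs_neq.
have Oh : Omega (h *: v + x).
  by near: h; apply: xhv; exact: open_nbhs_nbhs.
have := exp _ _ Oh Ox; rewrite addrK !normrZ normfV mulrCA.
by rewrite ler_pdivlMl ?normr_gt0.
Unshelve. all: by end_near. Qed.

Lemma cg_lambda_gt0 {R : realType} {d : nat} (Omega : set 'rV[R]_d)
    (u : 'rV[R]_d * R -> 'rV[R]_d) (a b : R) (Phi : 'rV[R]_d -> 'rV[R]_d) x :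
    (0 < d)%N -> open Omega -> [lipschitz u z | z in Omega `*` [set: R]] ->
    is_flow_map Omega u a b Phi -> Omega x -> differentiable Phi x ->
  0 < cg_lambda Phi x.
Proof.
move=> d0 oO uL flow Ox dPhi; have [C exp] := flow_map_expansion _ _ _ _ _ uL flow.
rewrite /cg_lambda /cauchy_green /grad trmxK; apply: lambda_max_gram_gt0 => // v.
exact: expansive_jacobian_inj oO Ox dPhi exp.
Qed.

(** * Transfer of ridges *)

(** Positivity of [b] is essential: for [b <= 0] the right-hand logarithm is [0]
    by convention, and any [a] in the interval from [0] to [1] would satisfy
    the inequality. *)
Lemma ln_sqrt_le {R : realType} (a b : R) :
  0 < b -> ln (Num.sqrt a) <= ln (Num.sqrt b) -> a <= b.
Proof.
move=> b0; have [a0 _|a0] := leP a 0; first exact: le_trans a0 (ltW b0).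
by rewrite ler_ln ?posrE ?sqrtr_gt0// ler_sqrt// ltW.
Qed.

Theorem theorem4p1 (R : realType) (d : nat) (Omega : set 'rV[R]_d)
    (u : 'rV[R]_d * R -> 'rV[R]_d) (t : R) (Phi : 'rV[R]_d -> 'rV[R]_d)
    (hOmega : bounded_domain Omega)
    (hu : [lipschitz u z | z in Omega `*` [set: R]])
    (ht : t != 0)
    (hPhi : is_flow_map Omega u 0 t Phi)
    (hdiff : forall x, Omega x -> differentiable Phi x) :
  forall M : set 'rV[R]_d,
    ridge Omega (ftle t Phi) M -> ridge Omega (cg_lambda Phi) M.
Proof.
move=> M [M1 Mc MO Mmax]; split=> // x n Mx nx.
have [delta delta0 fmax] := Mmax x n Mx nx.
exists delta => [|s /fmax[Os fs]]; first exact: delta0.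
split; first exact: Os.
have d0 : (0 < d)%N.
  (* In dimension zero there is no unit normal. *)
  rewrite lt0n; apply/eqP => d0; have [+ _] := nx; rewrite dotvE big1.
    by move/eqP; rewrite eq_sym oner_eq0.
  by move=> i _; have := ltn_ord i; rewrite [X in (_ < X)%N]d0.
have [oO _ _ _] := hOmega; have Ox := MO x Mx.
have lx0 := cg_lambda_gt0 Omega u 0 t _ _ d0 oO hu hPhi Ox (hdiff x Ox).
apply: ln_sqrt_le lx0 _; move: fs; rewrite /ftle ler_pM2l//.
by rewrite invr_gt0 normr_gt0.
Qed.
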